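(* A function $f\colon\Sigma^*\to\Gamma^*$ is defined by an FO translation if and only if it is defined by a single-valued aperiodic finite transducer.
   Context: Words $w=w_1\cdots w_n$ over a finite alphabet $\Sigma$ are viewed as finite structures with universe $\{1,\dots,n\}$, unary predicates $P_a$ ($P_a(j)$ iff $w_j=a$), the linear order $<$, equality, and constants min, max; FO denotes first-order logic over this signature (no BIT). An FO translation to the ordered alphabet $\Gamma=(c_1,\dots,c_t)$ is given by FO formulas $\phi_1(x),\dots,\phi_{t-1}(x)$ with one free variable $x$; it maps $w$ of length $n$ to the word $v$ of length $n$ with $v_i=c_j$ for the least $j$ such that $w\models\phi_j(i)$, and $v_i=c_t$ if there is no such $j$. A finite transducer $M$ consists of a finite set $Q$ of states, input alphabet $\Sigma$, output alphabet $\Gamma$, initial state $q_0$, transition relation $\delta\subseteq Q\times\Sigma\times\Gamma\times Q$ and final states $F\subseteq Q$. For $w=w_1\cdots w_n$, the set $O_M(w)$ consists of all $v\in\Gamma^n$ for which there are states $s_0=q_0,s_1,\dots,s_n$ with $s_n\in F$ and $(s_{i-1},w_i,v_i,s_i)\in\delta$ for all $1\le i\le n$. $M$ is single-valued if $|O_M(w)|=1$ for every $w\in\Sigma^*$; it then defines the function mapping $w$ to the unique element of $O_M(w)$. For a state $s$ and $u\in\Sigma^*$, $\delta^*(s,u)$ is the set of states reachable from $s$ by reading $u$ (with any outputs). $M$ is aperiodic if there is $N\in\mathbb N$ such that $\delta^*(q,w^N)=\delta^*(q,w^{N+1})$ for all states $q$ and all words $w$. *)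

(* Defs.v *)
From mathcomp Require Import all_boot.

Set Implicit Arguments.
Unset Strict Implicit.
Unset Printing Implicit Defensive.

(* [formula Sigma k] is well scoped: its free variables are among the k
   de Bruijn indices 0, ..., k-1; a quantifier binds index 0 and shifts the
   others. *)
Inductive term (k : nat) : Type :=
| Var of 'I_k
| Min
| Max.

Inductive formula (Sigma : finType) (k : nat) : Type :=
| Letter of Sigma & term k
| Less of term k & term k
| Equal of term k & term k
| Not of formula Sigma k
| And of formula Sigma k & formula Sigma k
| Or of formula Sigma k & formula Sigma k
| Exists of formula Sigma k.+1
| Forall of formula Sigma k.+1.

Arguments Min {k}.
Arguments Max {k}.

(* The constants need a nonempty universe, so satisfaction is defined on words
   of length n.+1; positions are numbered from 0. *)
Definition eval_term n k (rho : k.-tuple 'I_n.+1) (x : term k) : 'I_n.+1 :=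
  match x with
  | Var i => tnth rho i
  | Min => ord0
  | Max => ord_max
  end.

Fixpoint sat (Sigma : finType) n (w : n.+1.-tuple Sigma) k
    (phi : formula Sigma k) : k.-tuple 'I_n.+1 -> bool :=
  match phi with
  | Letter a x => fun rho => tnth w (eval_term rho x) == a
  | Less x y => fun rho => eval_term rho x < eval_term rho y
  | Equal x y => fun rho => eval_term rho x == eval_term rho y
  | Not p => fun rho => ~~ sat w p rho
  | And p q => fun rho => sat w p rho && sat w q rho
  | Or p q => fun rho => sat w p rho || sat w q rho
  | Exists p => fun rho => [exists j : 'I_n.+1, sat w p (cons_tuple j rho)]
  | Forall p => fun rho => [forall j : 'I_n.+1, sat w p (cons_tuple j rho)]
  end.

(* [find] returns the least index of a formula satisfied at i, and t (the index
   of the last letter of c) if there is none. *)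
Definition output_letter (Sigma Gamma : finType) t (c : t.+1.-tuple Gamma)
    (phi : t.-tuple (formula Sigma 1)) n (w : n.+1.-tuple Sigma)
    (i : 'I_n.+1) : Gamma :=
  nth (tnth c ord_max) c (find (fun p => sat w p [tuple i]) phi).

Definition fo_translation (Sigma Gamma : finType) t (c : t.+1.-tuple Gamma)
    (phi : t.-tuple (formula Sigma 1)) (w : seq Sigma) : seq Gamma :=
  match w with
  | [::] => [::]
  | a :: u => [seq output_letter c phi (cons_tuple a (in_tuple u)) i
                 | i <- enum 'I_(size u).+1]
  end.

Record transducer (Sigma Gamma : finType) : Type := Transducer {
  state : finType;
  init : state;
  delta : {set state * Sigma * Gamma * state};
  final : {set state}
}.

(* The components of s are s_0, ..., s_n, those of w and v are numbered from 0,
   so letter i is read between s_i and s_(i+1). *)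
Definition outputs (Sigma Gamma : finType) (M : transducer Sigma Gamma)
    n (w : n.-tuple Sigma) : {set n.-tuple Gamma} :=
  [set v : n.-tuple Gamma | [exists s : n.+1.-tuple (state M),
    [&& tnth s ord0 == init M,
        tnth s ord_max \in final M &
        [forall i : 'I_n,
          (tnth s (widen_ord (leqnSn n) i), tnth w i, tnth v i,
           tnth s (lift ord0 i)) \in delta M]]]].

Definition single_valued (Sigma Gamma : finType)
    (M : transducer Sigma Gamma) : Prop :=
  forall n (w : n.-tuple Sigma), #|outputs M w| = 1.

Definition defines (Sigma Gamma : finType) (M : transducer Sigma Gamma)
    (f : seq Sigma -> seq Gamma) : Prop :=
  forall n (w : n.-tuple Sigma),
    exists2 v : n.-tuple Gamma, v \in outputs M w & f w = v.

Fixpoint delta_star (Sigma Gamma : finType) (M : transducer Sigma Gamma)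
    (s : state M) (u : seq Sigma) : {set state M} :=
  match u with
  | [::] => [set s]
  | a :: u' =>
      \bigcup_(s' : state M | [exists b : Gamma, (s, a, b, s') \in delta M])
        delta_star s' u'
  end.

Definition word_pow (Sigma : Type) (w : seq Sigma) (N : nat) : seq Sigma :=
  flatten (nseq N w).

Definition aperiodic (Sigma Gamma : finType)
    (M : transducer Sigma Gamma) : Prop :=
  exists N : nat, forall (q : state M) (w : seq Sigma),
    delta_star q (word_pow w N) = delta_star q (word_pow w N.+1).

(* Main.v *)
(* From translations to transducers: each FO formula is recognised by a morphism
   to a finite aperiodic semigroup, by induction on the formula; the quantifier
   step records the class of the word and the classes of all its one-position
   markings. A transducer carries the class of the prefix and guesses the class
   of the suffix, which is verified backwards, so it has one accepting run per
   word.
   From transducers to translations: the subset automaton of an aperiodic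
   transducer is counter-free, so by Wilke's form of Schuetzenberger's theorem
   its languages are star-free, hence FO definable on every interval of
   positions. The letter at x is b iff some transition with output b at x is
   compatible with the prefix before x and the suffix after x; here
   single-valuedness makes local choices consistent. *)
Require Import Defs.
From mathcomp Require Import all_boot zify.

Set Implicit Arguments.
Unset Strict Implicit.
Unset Printing Implicit Defensive.

(** * Star-free languages of counter-free automata *)

Lemma word_powS (A : Type) (w : seq A) n : word_pow w n.+1 = w ++ word_pow w n.
Proof. by []. Qed.

Lemma word_powD (A : Type) (w : seq A) m n :
  word_pow w (m + n) = word_pow w m ++ word_pow w n.
Proof. by rewrite /word_pow nseqD flatten_cat. Qed.

Lemma map_word_pow (A B : Type) (f : A -> B) w n :
  map f (word_pow w n) = word_pow (map f w) n.
Proof. by rewrite /word_pow map_flatten map_nseq. Qed.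

Definition concat (A : Type) (L K : pred (seq A)) : pred (seq A) :=
  fun w => [exists i : 'I_(size w).+1, L (take i w) && K (drop i w)].

Lemma concatP (A : Type) (L K : pred (seq A)) w :
  reflect (exists u v, [/\ w = u ++ v, L u & K v]) (concat L K w).
Proof.
apply: (iffP existsP) => [[i /andP[Li Ki]]|[u [v [-> Lu Kv]]]].
  by exists (take i w), (drop i w); rewrite cat_take_drop.
have le_u : size u < (size (u ++ v)).+1 by rewrite ltnS size_cat leq_addr.
by exists (Ordinal le_u); rewrite /= take_size_cat // drop_size_cat // Lu.
Qed.

(** Languages are boolean predicates on words, so [SFext] is what closes the class under extensional
    equality. *)
Inductive star_free (A : finType) : pred (seq A) -> Prop :=
| SFnil : star_free (fun w => w == [::])
| SFletter a : star_free (fun w => w == [:: a])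
| SFnot L of star_free L : star_free (fun w => ~~ L w)
| SFor L K of star_free L & star_free K : star_free (fun w => L w || K w)
| SFcat L K of star_free L & star_free K : star_free (concat L K)
| SFext (L K : pred (seq A)) of L =1 K & star_free L : star_free K.

Section StarFreeClosure.
Variable A : finType.
Implicit Types L K : pred (seq A).

Lemma star_free_and L K :
  star_free L -> star_free K -> star_free (fun w => L w && K w).
Proof.
move=> sfL sfK; apply: SFext (SFnot (SFor (SFnot sfL) (SFnot sfK))) => w.
by rewrite negb_or !negbK.
Qed.

Lemma star_free_const b : star_free (fun _ : seq A => b).
Proof.
have sfT : star_free (fun _ : seq A => true).
  by apply: SFext (SFor (SFnil A) (SFnot (SFnil A))) => w; case: (w == _).
by case: b => //; apply: SFext (SFnot sfT).
Qed.

Lemma star_free_exists (I : finType) (P : pred I) (L : I -> pred (seq A)) :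
  (forall i, P i -> star_free (L i)) ->
  star_free (fun w => [exists (i | P i), L i w]).
Proof.
move=> sfL; have sf_has (s : seq I) :
    star_free (fun w => has (fun i => P i && L i w) s).
  elim: s => [|i s IHs]; first exact: star_free_const.
  apply: SFor IHs; have [Pi|_] := boolP (P i); first exact: sfL.
  exact: star_free_const.
apply: SFext (sf_has (enum I)) => w; apply/hasP/existsP => [[i _ Li]|[i Li]].
  by exists i.
by exists i; rewrite ?mem_enum.
Qed.

Lemma star_free_forall (I : finType) (P : pred I) (L : I -> pred (seq A)) :
  (forall i, P i -> star_free (L i)) ->
  star_free (fun w => [forall (i | P i), L i w]).
Proof.
move=> sfL; have sfN i : P i -> star_free (fun w => ~~ L i w).
  by move=> Pi; apply: SFnot (sfL i Pi).
apply: SFext (SFnot (star_free_exists sfN)) => w.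
by rewrite negb_exists_in; apply: eq_forallb => i; rewrite negbK.
Qed.

(** The complement of the union, over the letters a outside [B], of the languages A* a A*. *)
Lemma star_free_all (B : {set A}) : star_free (fun w => all [in B] w).
Proof.
have sfT := star_free_const true.
apply: SFext (SFnot (@star_free_exists A [in ~: B] _ (fun a _ =>
  SFcat sfT (SFcat (SFletter a) sfT)))) => w.
apply/idP/idP => [|wB].
  rewrite -[all _ w]negbK -has_predC; apply: contra => /hasP[a aw /= aB].
  apply/exists_inP; exists a; first by rewrite inE.
  apply/concatP; have [u v] := splitPr aw.
  exists u, (a :: v); split=> //; apply/concatP.
  by exists [:: a], v; split.
apply/negP => /exists_inP[a]; rewrite inE => aB.
case/concatP => u [z [def_w _ /concatP[y [v [def_z /eqP def_y _]]]]].
by move: wB; rewrite def_w def_z def_y all_cat /= (negPf aB) andbF.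
Qed.

End StarFreeClosure.

Section Runs.
Variables (Q A : finType) (act : Q -> A -> Q).

Definition counter_free (S : {set Q}) (B : {set A}) : Prop :=
  forall w, all [in B] w -> exists N, forall x, x \in S ->
    foldl act x (word_pow w N) = foldl act x (word_pow w N.+1).

Lemma foldl_stable (S : {set Q}) (B : {set A}) x w :
  (forall x a, x \in S -> a \in B -> act x a \in S) ->
  x \in S -> all [in B] w -> foldl act x w \in S.
Proof.
move=> stS; elim: w x => //= a w IHw x xS /andP[aB wB].
by apply: IHw => //; apply: stS.
Qed.

(* On finitely many states a counter-free letter that acts injectively acts
   trivially, so any other letter shrinks the set of states. *)
Lemma counter_free_shrink (S : {set Q}) (B : {set A}) c x :
  (forall x a, x \in S -> a \in B -> act x a \in S) -> counter_free S B ->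
  c \in B -> x \in S -> act x c != x ->
  #|[set act y c | y in S]| < #|S|.
Proof.
move=> stS cfS cB xS xc; rewrite ltn_neqAle leq_imset_card andbT.
apply: contra xc => /imset_injP injc.
have [|N powN] := cfS [:: c]; first by rewrite /= cB.
have injN n y z : y \in S -> z \in S ->
    foldl act y (word_pow [:: c] n) = foldl act z (word_pow [:: c] n) -> y = z.
  elim: n y z => //= n IHn y z yS zS /IHn eq_yz.
  by apply: injc => //; apply: eq_yz; apply: stS.
(* Reading c^N from [act x c] and from [x] ends in the same state, so the injectivity of c^N on [S]
   gives [act x c = x]. *)
by apply/eqP/esym/(injN N); rewrite ?stS // powN.
Qed.

(** * Words cut into blocks at a fixed letter *)

Section Blocks.

Variables (S : {set Q}) (B : {set A}) (c : A).
Hypothesis stS : forall x a, x \in S -> a \in B -> act x a \in S.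
Hypothesis cfS : counter_free S B.
Hypothesis cB : c \in B.

Let B' := B :\ c.
Let T := {ffun Q -> Q}.

(* The trace on S of the action of a word; outside S it is the identity, so
   that it is determined by finitely many runs inside S. *)
Definition trace_step (tau : T) (a : A) : T :=
  [ffun x => if x \in S then act (tau x) a else x].

Definition trace (w : seq A) : T := foldl trace_step [ffun x => x] w.

(** Reachability from the identity makes this a finite set given by a boolean test, although [B']
    may have infinitely many words. *)
Definition traces : {set T} :=
  [set tau | connect (fun t1 t2 => [exists b in B', t2 == trace_step t1 b])
                     [ffun x => x] tau].

(** The letter [tau] stands for a block u c with u of trace [tau]: first u acts, then c. *)
Definition block_act (x : Q) (tau : T) : Q := act (tau x) c.

(* A word u_1 c u_2 c ... u_k c with the u_i free of c is read as the word of
   the traces of the u_i. *)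
Fixpoint blocks_from (tau : T) (w : seq A) : seq T :=
  if w is a :: w' then
    if a == c then tau :: blocks_from [ffun x => x] w'
    else blocks_from (trace_step tau a) w'
  else [::].

Definition blocks := blocks_from [ffun x => x].

(** The default [c] of [last] lets the empty word count as a product of zero blocks. *)
Definition block_word (w : seq A) := all [in B] w && (last c w == c).

Lemma traceE w : trace w = [ffun x => if x \in S then foldl act x w else x].
Proof.
elim/last_ind: w => [|w a IHw]; apply/ffunP => x.
  by rewrite !ffunE; case: ifP.
rewrite /trace foldl_rcons -/(trace w) IHw !ffunE foldl_rcons.
by case: (x \in S).
Qed.

Lemma tracesP tau :
  reflect (exists2 u, all [in B'] u & tau = trace u) (tau \in traces).
Proof.
rewrite inE; apply: (iffP connectP) => [[p]|[u uB ->]].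
  elim/last_ind: p tau => [|p t IHp] tau /=; first by move=> _ ->; exists [::].
  rewrite rcons_path last_rcons => /andP[ep /existsP[b /andP[bB /eqP->]]] ->.
  have [u uB ->] := IHp _ ep erefl; exists (rcons u b).
    by rewrite all_rcons bB.
  by rewrite /trace foldl_rcons.
elim/last_ind: u uB => [|u b IHu]; first by exists [::].
rewrite all_rcons => /andP[bB /IHu[p ep eq_u]].
exists (rcons p (trace (rcons u b)));
  rewrite ?last_rcons // rcons_path ep -eq_u.
by apply/existsP; exists b; rewrite bB /trace foldl_rcons eqxx.
Qed.

Lemma sub_B' w : all [in B'] w -> all [in B] w.
Proof. by apply: sub_all => a; rewrite inE => /andP[]. Qed.

Lemma blocks_fromE tau u w : all [in B'] u ->
  blocks_from tau (u ++ c :: w) = foldl trace_step tau u :: blocks w.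
Proof.
elim: u tau => [|a u IHu] tau /=; first by rewrite eqxx.
by rewrite !inE => /andP[/andP[/negPf-> _] /IHu].
Qed.

Lemma blocks_cons u w : all [in B'] u ->
  blocks (u ++ c :: w) = trace u :: blocks w.
Proof. exact: blocks_fromE. Qed.

Lemma block_word_cons u w : all [in B'] u ->
  block_word (u ++ c :: w) = block_word w.
Proof.
by move=> /sub_B' uB; rewrite /block_word all_cat last_cat /= uB cB.
Qed.

Lemma block_word_cat v w :
  block_word v -> block_word w -> block_word (v ++ w).
Proof.
case/andP=> vB /eqP lv /andP[wB lw].
by rewrite /block_word all_cat last_cat lv vB wB.
Qed.

(** The cut is made right after the last c. *)
Lemma block_word_split w : all [in B] w ->
  exists v u, [/\ w = v ++ u, block_word v & all [in B'] u].
Proof.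
elim: w => [|a w IHw] /=; first by exists [::], [::]; rewrite /block_word /=.
move=> /andP[aB /IHw[[|b v] [u [-> /andP[vB lv] uB]]]]; last first.
  by exists (a :: b :: v), u; split=> //; rewrite /block_word /= aB lv andbT.
have [->|neq_ac] := eqVneq a c; last first.
  by exists [::], (a :: u); rewrite /block_word /= !inE neq_ac aB.
by exists [:: c], u; rewrite /block_word /= cB.
Qed.

(** The cut is made at the first c. *)
Lemma block_word_head w : block_word w -> w != [::] ->
  exists u v, [/\ w = u ++ c :: v, all [in B'] u & block_word v].
Proof.
elim: w => // a w IHw bw _; have [eq_ac|neq_ac] := eqVneq a c.
  exists [::], w; rewrite eq_ac; split=> //; move: bw.
  by rewrite eq_ac (@block_word_cons [::]).
case: w IHw bw => [|b w] IHw /andP[/= /andP[aB wB] lw].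
  by rewrite (negPf neq_ac) in lw.
have [||u [v [-> uB bv]]] := IHw; rewrite /block_word //= ?wB //.
by exists (a :: u), v; split=> //; rewrite /= !inE neq_ac aB.
Qed.

Lemma block_word_ind (P : seq A -> Prop) : P [::] ->
  (forall u w, all [in B'] u -> block_word w -> P w -> P (u ++ c :: w)) ->
  forall w, block_word w -> P w.
Proof.
move=> P0 PS w; have [n] := ubnP (size w); elim: n w => // n IHn w ltn bw.
have [->//|w0] := eqVneq w [::].
have [u [v [def_w uB bv]]] := block_word_head bw w0.
rewrite def_w; apply: PS => //; apply: IHn => //.
move: ltn; rewrite def_w size_cat /= ltnS; apply: leq_trans.
exact: leq_addl.
Qed.

Lemma blocks_cat v w : block_word v -> blocks (v ++ w) = blocks v ++ blocks w.
Proof.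
by elim/block_word_ind=> // u v' uB _ IH; rewrite -catA /= !blocks_cons //= IH.
Qed.

Lemma block_word_pow v n : block_word v ->
  block_word (word_pow v n) /\ blocks (word_pow v n) = word_pow (blocks v) n.
Proof.
move=> bv; elim: n => [|n [IH1 IH2]]; first by rewrite /block_word /=.
by rewrite !word_powS blocks_cat // IH2; split=> //; apply: block_word_cat.
Qed.

Lemma blocks_traces v : block_word v -> all [in traces] (blocks v).
Proof.
elim/block_word_ind=> // u w uB _ IH; rewrite blocks_cons //= IH andbT.
by apply/tracesP; exists u.
Qed.

Lemma blocks_surj s : all [in traces] s ->
  exists2 v, block_word v & blocks v = s.
Proof.
elim: s => [|tau s IHs] /=; first by exists [::]; rewrite /block_word /=.
case/andP=> /tracesP[u uB ->] /IHs[v bv <-].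
by exists (u ++ c :: v); rewrite ?block_word_cons ?blocks_cons.
Qed.

(** Every block ends in c, so it maps [S] into the image of [S] under c. *)
Lemma block_act_stable x tau : x \in S -> tau \in traces ->
  block_act x tau \in [set act y c | y in S].
Proof.
move=> xS /tracesP[u /sub_B' uB ->].
by rewrite /block_act traceE ffunE xS imset_f // (foldl_stable stS).
Qed.

Lemma sub_image x : x \in [set act y c | y in S] -> x \in S.
Proof. by case/imsetP=> y yS ->; apply: stS. Qed.

Lemma foldl_blocks x v : block_word v -> x \in S ->
  foldl block_act x (blocks v) = foldl act x v.
Proof.
move=> bv; elim/block_word_ind: v / bv x => // u w uB _ IH x xS.
have uS : foldl act x u \in S by rewrite (foldl_stable stS) ?sub_B'.
rewrite blocks_cons //= foldl_cat /= /block_act traceE ffunE xS.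
by apply: IH; apply: stS.
Qed.


(** Every word of traces is read off from an actual block word v, and its powers from the powers of
    v. From a state in the image of c, which lies in [S], both lead to the same state, so the
    exponent of v serves. *)
Lemma counter_free_blocks w : all [in traces] w ->
  exists N, forall x, x \in [set act y c | y in S] ->
    foldl block_act x (word_pow w N) = foldl block_act x (word_pow w N.+1).
Proof.
move=> /blocks_surj[v bv <-]; have [|N powN] := cfS (w := v).
  by case/andP: bv.
exists N => x /sub_image xS.
have [bN <-] := block_word_pow N bv; have [bN1 <-] := block_word_pow N.+1 bv.
by rewrite !foldl_blocks // powN.
Qed.

(** This is what the induction on the alphabet provides, since [B'] has one letter less than [B]. *)
Hypothesis star_free_letters : forall x y, x \in S ->
  star_free (fun w => all [in B'] w && (foldl act x w == y)).

(** On [S] a trace is fixed by finitely many end states, each a star-free condition; outside [S] it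
    is the identity, which constrains [tau] alone and gives a constant language. *)
Lemma star_free_trace tau :
  star_free (fun w => all [in B'] w && (trace w == tau)).
Proof.
have sf_loc := @star_free_forall _ _ [in S] _ (fun x =>
  star_free_letters (tau x)).
have sf_out := star_free_const A [forall (x | x \notin S), tau x == x].
apply: SFext (star_free_and (star_free_all B') (star_free_and sf_out sf_loc)).
move=> w /=; case wB: (all _ w) => //=; rewrite traceE.
apply/andP/eqP => [[/forall_inP out /forall_inP loc]|<-].
  apply/ffunP => x; rewrite ffunE.
  by case: ifPn => [/loc/eqP|/out/eqP].
by split; apply/forall_inP => x xS; rewrite ffunE ?xS ?(negPf xS).
Qed.

(** Induction on [K]: the letter [tau] becomes the words u c with u of trace [tau], complements are
    taken among block words, and a cut between two traces lifts to a cut into two block words. *)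
Lemma star_free_blocks K : star_free K ->
  star_free (fun w => block_word w && K (blocks w)).
Proof.
elim=> {K} [|tau|L _ IHL|L K _ IHL _ IHK|L K _ IHL _ IHK|L K eqLK _ IHL].
- apply: SFext (SFnil A) => w; apply/eqP/andP => [->|[bw]].
    by rewrite /block_word /= !eqxx.
  have [//|w0] := eqVneq w [::].
  by have [u [v [-> uB bv]]] := block_word_head bw w0; rewrite blocks_cons.
- apply: SFext (SFcat (star_free_trace tau) (SFletter c)) => w.
  apply/concatP/andP => [[u [v [-> /andP[uB /eqP <-] /eqP ->]]]|[bw]].
    by rewrite blocks_cons ?block_word_cons /block_word /= ?eqxx.
  have [->//|w0] := eqVneq w [::].
  have [u [v [-> uB bv]]] := block_word_head bw w0.
  rewrite blocks_cons // => /eqP[def_tau v0].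
  exists u, [:: c]; rewrite uB def_tau eqxx; split=> //; congr (_ ++ _ :: _).
  have [//|/(block_word_head bv)[u1 [v1 [def_v uB1 _]]]] := eqVneq v [::].
  by rewrite def_v blocks_cons in v0.
(* The complement is relative to the block words, so these must be star-free themselves: words over
   [B] that are empty or end in c. *)
- have sfD : star_free block_word.
    have sfl := SFor (SFnil A) (SFcat (star_free_const A true) (SFletter c)).
    apply: SFext (star_free_and (star_free_all B) sfl) => w.
    rewrite /block_word; congr (_ && _); apply/orP/eqP.
      by case=> [/eqP->//|/concatP[u [v [-> _ /eqP->]]]]; rewrite last_cat.
    case/lastP: w => [|w a]; first by left.
    rewrite last_rcons => ->; right; apply/concatP.
    by exists w, [:: c]; rewrite cats1.
  apply: SFext (star_free_and sfD (SFnot IHL)) => w.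
  by case: (block_word w).
- apply: SFext (SFor IHL IHK) => w.
  by case: (block_word w).
- apply: SFext (SFcat IHL IHK) => w.
  apply/concatP/andP => [[u [v [-> /andP[bu Lu] /andP[bv Kv]]]]|[bw]].
    rewrite block_word_cat // blocks_cat //; split=> //; apply/concatP.
    by exists (blocks u), (blocks v).
  case/concatP=> s1 [s2 [def_w Ls1 Ks2]].
  suff [u [v [def_uv bu bv eq1 eq2]]] : exists u v,
      [/\ w = u ++ v, block_word u, block_word v,
        blocks u = s1 & blocks v = s2].
    by exists u, v; rewrite bu bv eq1 eq2.
  elim: s1 w bw def_w {Ls1} => [|tau s1 IHs] w bw def_w.
    by exists [::], w; rewrite /block_word /= eqxx.
  have w0 : w != [::] by apply: contra_eq_neq def_w => ->.
  have [u [v [def_uv uB bv]]] := block_word_head bw w0.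
  move: def_w; rewrite def_uv blocks_cons //= => -[def_tau /(IHs _ bv)].
  case=> u1 [v1 [-> bu1 bv1 <- <-]]; exists (u ++ c :: u1), v1.
  by rewrite -catA /= block_word_cons // blocks_cons // def_tau.
- by apply: SFext IHL => w; rewrite eqLK.
Qed.

End Blocks.
End Runs.

(* Wilke's induction: cut a word at the occurrences of a letter c that acts
   nontrivially; the words between them use a smaller alphabet, while the word
   of their traces acts on the smaller set of states S c. *)
Theorem counter_free_star_free (Q A : finType) (act : Q -> A -> Q)
    (S : {set Q}) (B : {set A}) :
  (forall x a, x \in S -> a \in B -> act x a \in S) ->
  counter_free act S B -> forall x y, x \in S ->
  star_free (fun w => all [in B] w && (foldl act x w == y)).
Proof.
(* The outer induction varies the alphabet too, since it is applied to words whose letters are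
   traces. *)
have [m] := ubnP #|S|; elim: m => // m IHm in A act S B *; rewrite ltnS => leSm.
have [p] := ubnP #|B|; elim: p => // p IHp in B *; rewrite ltnS => leBp.
move=> stS cfS x y xS.
have [/existsP[c /andP[cB /exists_inP[z zS zc]]]|] :=
    boolP [exists c in B, [exists z in S, act z c != z]]; last first.
  (* No letter of [B] moves a state of [S], so the run never leaves [x]. *)
  rewrite negb_exists_in => /forall_inP triv.
  apply: SFext (star_free_and (star_free_all B) (star_free_const A (x == y))).
  move=> w; case wB: (all _ w) => //=; congr (_ == _).
  elim: w wB => //= a w IHw /andP[/triv + /IHw].
  by rewrite negb_exists_in => /forall_inP/(_ x xS)/negPn/eqP->.
have sfB' u v : u \in S ->
    star_free (fun w => all [in B :\ c] w && (foldl act u w == v)).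
  apply: IHp => [|u' a u'S /setD1P[_ aB]|w wB]; last exact/cfS/(sub_B' wB).
  - by apply: leq_trans leBp; rewrite [#|B|](cardsD1 c) cB.
  - exact: stS.
pose S' := [set act y c | y in S].
have sfT u v : u \in S' -> star_free (fun w => all [in traces act S B c] w &&
    (foldl (block_act act c) u w == v)).
  apply: IHm => [||].
  - exact: leq_trans (counter_free_shrink stS cfS cB zS zc) leSm.
  - move=> u' tau /imsetP[u1 u1S ->] tauT.
    by apply: (block_act_stable stS); rewrite ?stS.
  - exact: counter_free_blocks.
pose mid u v w := block_word B c w && (foldl act u w == v).
have sf_mid u v : u \in S' -> star_free (mid u v).
  move=> uS'; have := star_free_blocks cB sfB' (sfT u v uS').
  apply: SFext => w; rewrite /mid; case bw: (block_word _ _ w) => //=.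
  rewrite blocks_traces //= (foldl_blocks stS) //.
  by case/imsetP: uS' => u' u'S ->; apply: stS.
(* A word containing c is u c v u' with v a block word and u, u' free of c; [r.1] is the state
   before its first c and [r.2] the state after its last. *)
have sf_split := star_free_exists
  (fun (r : Q * Q) (rS : (r.1 \in S) && (r.2 \in S)) =>
  SFcat (SFcat (sfB' x r.1 xS) (SFletter c))
    (SFcat (sf_mid (act r.1 c) r.2 (imset_f _ (proj1 (andP rS))))
       (sfB' r.2 y (proj2 (andP rS))))).
apply: SFext (SFor (sfB' x y xS) sf_split) => w.
apply/orP/andP => [[/andP[/sub_B' wB]//|/exists_inP[[r s] /andP[/= rS sS]]]|].
  case/concatP=> w1 [w2 [-> /concatP[u [v [-> /andP[uB /eqP ur] /eqP->]]]]].
  case/concatP=> v1 [u1 [-> /andP[/andP[v1B _] /eqP v1s] /andP[u1B u1y]]].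
  rewrite !all_cat !foldl_cat /= ur v1s u1y v1B cB.
  by rewrite (sub_B' uB) (sub_B' u1B).
case=> wB wy; have [v [u [def_w bv uB]]] := block_word_split cB wB.
have [v0|v0] := eqVneq v [::]; first by left; rewrite wy def_w v0 uB.
right; have [u1 [v1 [def_v u1B bv1]]] := block_word_head cB bv v0.
have rS : foldl act x u1 \in S by rewrite (foldl_stable stS) ?(sub_B' u1B).
pose r := foldl act x u1; pose s := foldl act (act r c) v1.
have sS : s \in S.
  by rewrite (foldl_stable stS) ?stS //; case/andP: bv1.
apply/exists_inP; exists (r, s); rewrite ?rS //=; apply/concatP.
exists (u1 ++ [:: c]), (v1 ++ u); rewrite def_w def_v -!catA; split=> //.
  by apply/concatP; exists u1, [:: c]; rewrite u1B !eqxx.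
apply/concatP; exists v1, u; rewrite /mid bv1 eqxx uB; split=> //=.
by rewrite -(eqP wy) def_w def_v !foldl_cat.
Qed.

(** * Star-free languages are first-order definable *)

Section Intervals.
Variable A : finType.

(* A cut is the boundary just before a position, or the end of the word. *)
Definition cut k := option (term k).

Definition cut_val n k (rho : k.-tuple 'I_n.+1) (x : cut k) : nat :=
  if x is Some s then eval_term rho s else n.+1.

Definition term_shift k (x : term k) : term k.+1 :=
  match x with Var i => Var (lift ord0 i) | Min => Min | Max => Max end.

Definition cut_shift k (x : cut k) : cut k.+1 := omap (@term_shift k) x.

(** The atoms [Equal A Min Min] and [Less A Min Min] serve as true and false. *)
Definition lt_cut k (x y : cut k) : formula A k :=
  match x, y with
  | Some s, Some t => Less A s t
  | Some _, None => Equal A Min Min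
  | None, _ => Less A Min Min
  end.

Definition slice (w : seq A) i j := drop i (take j w).

Lemma cut_val_shift n k (rho : k.-tuple 'I_n.+1) i (x : cut k) :
  cut_val (cons_tuple i rho) (cut_shift x) = cut_val rho x.
Proof. by case: x => [[l| |]|] //=; rewrite !(tnth_nth ord0). Qed.

Lemma cut_val_le n k (rho : k.-tuple 'I_n.+1) x : cut_val rho x <= n.+1.
Proof. by case: x => //= s; apply: ltnW. Qed.

Lemma satE n (w : n.+1.-tuple A) k (rho : k.-tuple 'I_n.+1) :
  ((forall p, sat w (Not p) rho = ~~ sat w p rho) *
  (forall p q, sat w (And p q) rho = sat w p rho && sat w q rho) *
  (forall p q, sat w (Or p q) rho = sat w p rho || sat w q rho) *
  (forall p, sat w (Exists p) rho = [exists j,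
    sat w p (cons_tuple j rho)]))%type.
Proof. by []. Qed.

Lemma sat_lt_cut n (w : n.+1.-tuple A) k (rho : k.-tuple 'I_n.+1) x y :
  sat w (lt_cut x y) rho = (cut_val rho x < cut_val rho y).
Proof.
case: x y => [s|] [t|] //=; rewrite ?ltnn ?eqxx ?ltn_ord //.
by apply/esym/negbTE; rewrite -leqNgt ltnW.
Qed.

Lemma slice_nil (w : seq A) i j : i <= j <= size w ->
  (slice w i j == [::]) = ~~ (i < j).
Proof.
case/andP=> ij jw; rewrite -size_eq0 size_drop size_takel // subn_eq0.
by rewrite -leqNgt.
Qed.

Lemma slice_letter (w : seq A) a i j : i <= j <= size w ->
  (slice w i j == [:: a]) = (j == i.+1) && (nth a w i == a).
Proof.
case/andP=> ij jw; have [def_j|neq] := eqVneq j i.+1; last first.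
  apply: contraNF neq => /eqP/(congr1 size)/eqP.
  by rewrite size_drop size_takel //= -(eqn_add2r i) subnK.
move: jw; rewrite def_j /slice => lt_iw.
rewrite (take_nth a) // -cats1 drop_size_cat ?size_takel 1?ltnW //.
by rewrite eqseq_cons andbT.
Qed.

Lemma slice_take (w : seq A) i m j : i <= m <= j ->
  slice w i m = take (m - i) (slice w i j).
Proof. by case/andP=> im mj; rewrite /slice take_drop subnK // take_takel. Qed.

Lemma slice_drop (w : seq A) i m j : i <= m ->
  slice w m j = drop (m - i) (slice w i j).
Proof. by move=> im; rewrite /slice drop_drop subnK. Qed.

Lemma slice_concat (L K : pred (seq A)) w i j : i <= j <= size w ->
  reflect (exists2 m, i <= m <= j & L (slice w i m) && K (slice w m j))
          (concat L K (slice w i j)).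
Proof.
case/andP=> ij jw; apply: (iffP (concatP _ _ _)) => [[u [v [def_uv Lu Kv]]]|].
  have bound : i <= size u + i <= j.
    rewrite leq_addl -(subnK ij) leq_add2r.
    have := congr1 size def_uv; rewrite size_drop size_takel // size_cat => ->.
    exact: leq_addr.
  exists (size u + i) => //; rewrite (slice_take _ bound).
  rewrite (slice_drop _ _ (leq_addl (size u) i)) def_uv addnK.
  by rewrite take_size_cat // drop_size_cat // Lu.
case=> m imj; have /andP[im _] := imj.
rewrite (slice_take _ imj) (slice_drop _ _ im) => /andP[Lu Kv].
exists (take (m - i) (slice w i j)), (drop (m - i) (slice w i j)).
by rewrite cat_take_drop.
Qed.

(* Quantifiers range over positions, so the cut at the end of the word is
   treated as a separate case of a concatenation. *)
Lemma star_free_definable L : star_free L ->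
  forall k (x y : cut k), exists phi : formula A k,
  forall n (w : n.+1.-tuple A) rho, cut_val rho x <= cut_val rho y ->
  sat w phi rho = L (slice w (cut_val rho x) (cut_val rho y)).
Proof.
elim=> {L} [|a|L _ IHL|L K _ IHL _ IHK|L K _ IHL _ IHK|L K eqLK _ IHL] k x y.
- exists (Not (lt_cut x y)) => n w rho xy /=.
  by rewrite sat_lt_cut slice_nil // size_tuple xy cut_val_le.
- case: x => [s|]; last first.
    exists (Less A Min Min) => n w rho /= xy; rewrite ltnn slice_letter.
      by rewrite ltn_eqF // ltnS cut_val_le.
    by rewrite size_tuple xy cut_val_le.
  (* Besides the letter, the formula says that [y] is the cut right after [x]: [x] is before [y] and
     no position lies strictly between them. *)
  exists (And (And (Letter a s) (lt_cut (Some s) y))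
    (Not (Exists (And (lt_cut (cut_shift (Some s)) (Some (Var ord0)))
                      (lt_cut (Some (Var ord0)) (cut_shift y)))))).
  move=> n w rho xy; rewrite slice_letter;
    last by rewrite size_tuple xy cut_val_le.
  move: xy; rewrite !satE !sat_lt_cut.
  set i := cut_val rho (Some s); set j := cut_val rho y => ij.
  have -> : sat w (Letter a s) rho = (nth a w i == a).
    by rewrite /= (tnth_nth a).
  rewrite -andbA [RHS]andbC; congr (_ && _).
  apply/andP/eqP => [[lt_ij /existsPn no]|def_j].
    apply/eqP; rewrite eqn_leq lt_ij andbT leqNgt; apply/negP => lt_Sij.
    have lt_Sin : i.+1 < n.+1 by apply: leq_trans lt_Sij (cut_val_le _ _).
    have := no (Ordinal lt_Sin); rewrite !satE !sat_lt_cut !cut_val_shift.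
    by rewrite /= ltnSn lt_Sij.
  rewrite def_j; split=> //; apply/existsPn => l.
  rewrite !satE !sat_lt_cut !cut_val_shift -/i -/j def_j /= tnth0 ltnS.
  by case: ltngtP.
- have [phi phiP] := IHL k x y; exists (Not phi) => n w rho xy /=.
  by rewrite phiP.
- have [phi phiP] := IHL k x y; have [psi psiP] := IHK k x y.
  by exists (Or phi psi) => n w rho xy /=; rewrite phiP // psiP.
- pose z : cut k.+1 := Some (Var ord0).
  have [p1 P1] := IHL k.+1 (cut_shift x) z.
  have [p2 P2] := IHK k.+1 z (cut_shift y).
  have [p3 P3] := IHL k x None; have [p4 P4] := IHK k None y.
  exists (Or (Exists (And (And (Not (lt_cut z (cut_shift x)))
                              (Not (lt_cut (cut_shift y) z))) (And p1 p2)))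
             (And (Not (lt_cut y None)) (And p3 p4))) => n w rho xy.
  have bound : cut_val rho x <= cut_val rho y <= size w.
    by rewrite size_tuple xy cut_val_le.
  rewrite !satE sat_lt_cut -leqNgt.
  apply/idP/(slice_concat _ _ bound) => [/orP[/existsP[l]|]|[m]].
  + rewrite !satE !sat_lt_cut !cut_val_shift /= -!leqNgt.
    case/andP=> /andP[xl ly]; rewrite P1 ?P2 ?cut_val_shift //= => LK.
    by exists l; rewrite ?xl.
  + case/andP=> ny.
    rewrite P3 ?P4 ?cut_val_le //= => LK; exists n.+1 => //.
    by rewrite cut_val_le.
  case/andP=> xm my; have [lt_m LK|le_m] := ltnP m n.+1.
    apply/orP; left; apply/existsP; exists (Ordinal lt_m).
    rewrite !satE !sat_lt_cut !cut_val_shift /= -!leqNgt xm my.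
    by rewrite P1 ?P2 ?cut_val_shift.
  have -> : m = n.+1.
    by apply/eqP; rewrite eqn_leq le_m andbT (leq_trans my) ?cut_val_le.
  move=> LK; apply/orP; right.
  by rewrite (leq_trans le_m my) P3 ?P4 ?cut_val_le ?(leq_trans le_m my).
- have [phi phiP] := IHL k x y; exists phi => n w rho xy.
  by rewrite phiP.
Qed.

End Intervals.

(** * From aperiodic transducers to translations *)

Section Definable.
Variables (A : finType) (k : nat).

Definition definable (P : forall n, n.+1.-tuple A -> k.-tuple 'I_n.+1 -> bool)
  :=
  exists phi : formula A k, forall n w rho, sat w phi rho = P n w rho.

Lemma definable_exists (I : finType) (D : pred I) P :
  (forall i, D i -> definable (P i)) ->
  definable (fun n w rho => [exists (i | D i), P i n w rho]).
Proof.
move=> defP; have [phi phiE] : definable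
    (fun n w rho => has (fun i => D i && P i n w rho) (enum I)).
  elim: (enum I) => [|i s [psi psiE]]; first by exists (Less A Min Min).
  have [Di|/negPf nDi] := boolP (D i); last first.
    by exists psi => n w rho; rewrite /= nDi.
  have [phi phiE] := defP i Di; exists (Or phi psi) => n w rho.
  by rewrite /= Di phiE psiE.
exists phi => n w rho; rewrite phiE.
apply/hasP/existsP => [[i _ Li]|[i Li]]; exists i; rewrite ?mem_enum //.
Qed.

Lemma definable_and P1 P2 : definable P1 -> definable P2 ->
  definable (fun n w rho => P1 n w rho && P2 n w rho).
Proof.
by case=> p1 E1 [p2 E2]; exists (And p1 p2) => n w rho; rewrite /= E1 E2.
Qed.

End Definable.

(** * Runs of a transducer and the letters it may output *)

Section Transducer.
Variables (Sigma Gamma : finType) (M : transducer Sigma Gamma).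
Implicit Types (s p q : state M) (u w : seq Sigma) (v y : seq Gamma).

(** Runs by recursion on the word and from an arbitrary state, so that they can be cut and glued. *)
Fixpoint accepts s w v : bool :=
  match w, v with
  | [::], [::] => s \in final M
  | a :: w', b :: v' =>
      [exists (s' | (s, a, b, s') \in delta M), accepts s' w' v']
  | _, _ => false
  end.

Lemma mem_outputs n (w : n.-tuple Sigma) (v : n.-tuple Gamma) :
  (v \in outputs M w) = accepts (init M) w v.
Proof.
rewrite inE; move: (init M) => s0; elim: n => [|n IHn] in s0 w v *.
  rewrite (tuple0 w) (tuple0 v) /=.
  apply/existsP/idP => [[s /and3P[/eqP <- sF _]]|s0F].
    by rewrite (_ : ord0 = ord_max) //; apply: val_inj.
  by exists [tuple s0]; apply/and3P; split=> //; apply/forallP => -[].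
case/tupleP: w => a w; case/tupleP: v => b v /=.
apply/existsP/exists_inP => [[s /and3P[/eqP s_0 sF /forallP s_d]]|[s' d_s']].
  case/tupleP: s s_0 sF s_d => s1 s; rewrite tnth0 => -> sF s_d.
  exists (tnth s ord0); last first.
    rewrite -IHn; apply/existsP; exists s; rewrite eqxx /=; apply/andP; split.
      by move: sF; rewrite !(tnth_nth s0).
    by apply/forallP => i; have := s_d (lift ord0 i);
      rewrite !(tnth_nth s0) ?(tnth_nth a) ?(tnth_nth b).
  by have := s_d ord0; rewrite !(tnth_nth s0) (tnth_nth a) (tnth_nth b).
rewrite -IHn => /existsP[s /and3P[/eqP s_0 sF /forallP s_d]].
exists (cons_tuple s0 s); rewrite tnth0 eqxx /=; apply/andP; split.
  by move: sF; rewrite !(tnth_nth s0).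
apply/forallP => i; case: (unliftP ord0 i) => [j|] ->.
  by have := s_d j; rewrite !(tnth_nth s0) ?(tnth_nth a) ?(tnth_nth b).
by move: d_s'; rewrite -s_0 !(tnth_nth s0) (tnth_nth a) (tnth_nth b).
Qed.

Lemma accepts_size s w v : accepts s w v -> size v = size w.
Proof.
by elim: w s v => [|a w IHw] s [|b v] //= /exists_inP[s' _ /IHw->].
Qed.

Lemma delta_star_consP s a u p :
  reflect (exists b s', (s, a, b, s') \in delta M /\ p \in delta_star s' u)
          (p \in delta_star s (a :: u)).
Proof.
apply: (iffP bigcupP) => [[s' /existsP[b d_s'] pu]|[b [s' [d_s' pu]]]].
  by exists b, s'.
by exists s' => //; apply/existsP; exists b.
Qed.

Lemma accepts_cat s u w y v : size y = size u -> accepts s (u ++ w) (y ++ v) ->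
  exists2 p, p \in delta_star s u & accepts p w v.
Proof.
elim: u s y => [|a u IHu] s [|b y] //=; first by exists s; rewrite ?inE.
case=> /IHu{}IHu /exists_inP[s' d_s' /IHu[p pu pw]].
by exists p => //; apply/delta_star_consP; exists b, s'.
Qed.

Lemma cat_accepts s u p w v : p \in delta_star s u -> accepts p w v ->
  exists2 y, size y = size u & accepts s (u ++ w) (y ++ v).
Proof.
elim: u s => [|a u IHu] s; first by rewrite inE => /eqP-> pw; exists [::].
case/delta_star_consP=> b [s' [d_s' /IHu{}IHu]] /IHu[y sz_y acc].
by exists (b :: y); rewrite /= ?sz_y //; apply/exists_inP; exists s'.
Qed.

Definition can_finish p u := [exists q in delta_star p u, q \in final M].

Lemma can_finishP p u : reflect (exists v, accepts p u v) (can_finish p u).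
Proof.
apply: (iffP exists_inP) => [[q qu qF]|[v acc]].
  by have [//|y _] := cat_accepts qu (v := [::]) (w := [::]);
    exists (y ++ [::]); rewrite -(cats0 u).
have [||q qu qF] := @accepts_cat p u [::] v [::]; first exact: accepts_size acc.
  by rewrite !cats0.
by exists q.
Qed.

Definition subset_step (S : {set state M}) (a : Sigma) : {set state M} :=
  \bigcup_(s in S) delta_star s [:: a].

Lemma foldl_subset_step S u :
  foldl subset_step S u = \bigcup_(s in S) delta_star s u.
Proof.
elim: u S => [|a u IHu] S.
  apply/setP => p; apply/idP/bigcupP => [pS|[s sS]]; first by exists p;
    rewrite ?inE.
  by rewrite inE => /eqP->.
rewrite [LHS]/= IHu; apply/setP => p; apply/bigcupP/bigcupP => [[s']|[s sS]].
  case/bigcupP=> s sS /delta_star_consP[b [s1 [d_s1]]];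
    rewrite inE => /eqP-> pu.
  by exists s => //; apply/delta_star_consP; exists b, s1.
case/delta_star_consP=> b [s' [d_s' pu]]; exists s' => //.
by apply/bigcupP; exists s => //; apply/delta_star_consP; exists b, s';
  rewrite inE.
Qed.

Hypothesis M_ap : aperiodic M.

(** The set reached is the state of the subset automaton, which inherits counter-freeness from
    aperiodicity; the language is the finite union over the sets satisfying [P]. *)
Lemma star_free_delta_star s (P : pred {set state M}) :
  star_free (fun u => P (delta_star s u)).
Proof.
have cf : counter_free subset_step [set: {set state M}] [set: Sigma].
  have [N powN] := M_ap; move=> w _; exists N => S _.
  by rewrite !foldl_subset_step; apply: eq_bigr => q _; apply: powN.
have sfS := counter_free_star_free (fun _ _ _ _ => in_setT _) cf.
apply: SFext (star_free_exists (P := P) (fun S _ => sfS [set s] S (in_setT _)))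
  => u.
rewrite foldl_subset_step big_set1;
  apply/exists_inP/idP => [[S PS /andP[_ /eqP->]]|Ps] //.
by exists (delta_star s u) => //; rewrite eqxx andbT; apply/allP.
Qed.

(** The triple [d] is the source, input letter and target of the transition at the position. Letter
    and remaining suffix form one concatenation, because the cut after the position is not given by
    a term. *)
Definition may_output b n (w : n.+1.-tuple Sigma) (rho : 1.-tuple 'I_n.+1) :
  bool :=
  [exists (d | (d.1.1, d.1.2, b, d.2) \in delta M),
    (d.1.1 \in delta_star (init M) (take (tnth rho ord0) w)) &&
    concat (fun u => u == [:: d.1.2]) (can_finish d.2) (drop (tnth rho ord0)
      w)].

Lemma definable_may_output b : definable (may_output b).
Proof.
apply: definable_exists => -[[p a] q] _ /=; apply: definable_and.
  have [phi phiE] := star_free_definable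
    (star_free_delta_star (init M) (fun S => p \in S))
    (Some Min) (Some (Var (@ord0 0))).
  by exists phi => n w rho; rewrite phiE //= /slice drop0.
have [phi phiE] := star_free_definable
  (SFcat (SFletter a)
     (star_free_delta_star q (fun S => [exists q' in S, q' \in final M])))
  (Some (Var (@ord0 0))) None.
exists phi => n w rho; rewrite phiE; last exact: cut_val_le.
by rewrite /slice /= take_oversize ?size_tuple.
Qed.

(** Runs on the prefix and on the suffix, with outputs left open, are glued at the chosen
    transition; conversely an accepting run is cut there. *)
Lemma may_outputP b n (w : n.+1.-tuple Sigma) (i : 'I_n.+1) :
  reflect (exists2 v, v \in outputs M w & tnth v i = b)
          (may_output b w [tuple i]).
Proof.
have tnth_i : tnth [tuple i] ord0 = i by [].
have sz_take : size (take i w) = i by rewrite size_takel // size_tuple ltnW.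
have drop_w : drop i w = tnth w i :: drop i.+1 w.
  by rewrite (drop_nth (tnth w i)) ?size_tuple // -tnth_nth.
rewrite /may_output tnth_i.
apply: (iffP exists_inP) => [[[[p a] q] /= d_q /andP[pu /concatP]]|[v]].
  case=> u1 [u2 [eq_drop /eqP def_u1 /can_finishP[v2 acc2]]].
  have def_w : take i w ++ a :: u2 = w.
    by rewrite -{2}(cat_take_drop i w) eq_drop def_u1.
  have [|y sz_y acc] := cat_accepts (w := a :: u2) (v := b :: v2) pu.
    by apply/exists_inP; exists q.
  have sz : size (y ++ b :: v2) == n.+1.
    by rewrite (accepts_size acc) def_w size_tuple.
  exists (Tuple sz); first by rewrite mem_outputs -{1}def_w.
  by rewrite (tnth_nth b) /= nth_cat sz_y sz_take ltnn subnn.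
rewrite mem_outputs => acc vi.
have def_v : v = take i v ++ b :: drop i.+1 v :> seq Gamma.
  by rewrite -[LHS](cat_take_drop i) (drop_nth b) ?size_tuple // -tnth_nth vi.
move: acc; rewrite -[X in accepts _ X](cat_take_drop i w) drop_w def_v.
case/accepts_cat=> [|p pu]; first by rewrite !size_takel ?size_tuple // ltnW.
case/exists_inP=> q d_q acc; exists (p, tnth w i, q) => //=; rewrite pu /=.
apply/concatP; exists [:: tnth w i], (drop i.+1 w); split=> //.
by apply/can_finishP; exists (drop i.+1 v).
Qed.

End Transducer.

(** A failed search in [s] returns its length, which is where [z] stands. Hence t tests suffice for
    t + 1 letters. *)
Lemma nth_index_belast (T : eqType) (x0 y : T) (s : seq T) z :
  y \in rcons s z -> nth x0 (rcons s z) (index y s) = y.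
Proof.
rewrite mem_rcons inE nth_rcons index_mem => /predU1P[->|ys].
  by case: ifP => [/nth_index//|/negbT/memNindex->]; rewrite eqxx.
by rewrite ys nth_index.
Qed.

Theorem aperiodic_fo_translation (Sigma Gamma : finType) t
    (c : t.+1.-tuple Gamma) (f : seq Sigma -> seq Gamma)
    (M : transducer Sigma Gamma) :
  (forall b, b \in c) -> single_valued M -> aperiodic M -> defines M f ->
  exists phi : t.-tuple (formula Sigma 1),
    forall w, f w = fo_translation c phi w.
Proof.
move=> c_full M_sv M_ap M_f.
have /fin_all_exists[phi phiE] : forall j : 'I_t, exists p : formula Sigma 1,
    forall n (w : n.+1.-tuple Sigma) rho,
      sat w p rho = may_output M (tnth c (widen_ord (leqnSn t) j)) w rho.
  by move=> j; apply: definable_may_output.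
exists [tuple phi j | j < t] => -[|a u].
  by have [v _ ->] := M_f 0 [tuple]; rewrite (tuple0 v).
pose w := cons_tuple a (in_tuple u); have [v Mv ->] := M_f _ w.
rewrite [LHS](_ : _ = [seq tnth v i | i <- enum 'I_(size u).+1]); last first.
  by rewrite map_tnth_enum.
apply: eq_map => i; rewrite /output_letter -/w.
(* By single-valuedness [v] is the only output word of [w], so its letter at [i] is the only
   possible one. *)
have mayE b : may_output M b w [tuple i] = (b == tnth v i).
  apply/may_outputP/eqP => [[v' Mv' <-]|->]; last by exists v.
  have /eqP/cards1P[v0 def_v0] := M_sv _ w.
  by move: Mv Mv'; rewrite def_v0 !inE => /eqP-> /eqP->.
have -> : find (fun p => sat w p [tuple i]) [tuple phi j | j < t] =
          index (tnth v i) (take t c).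
  have -> : take t c = [seq tnth c (widen_ord (leqnSn t) j) | j <- enum 'I_t].
    apply: (@eq_from_nth _ (tnth v i)) => [|k].
      by rewrite size_take size_tuple ltnSn size_map size_enum_ord.
    rewrite size_take size_tuple ltnSn => lt_kt.
    rewrite nth_take // (nth_map (Ordinal lt_kt)) ?size_enum_ord //.
    by rewrite (tnth_nth (tnth v i) c) /= nth_enum_ord.
  rewrite /index !find_map; apply: eq_find => j /=.
  by rewrite phiE mayE.
have def_c : c = rcons (take t c) (tnth c ord_max) :> seq Gamma.
  rewrite (tnth_nth (tnth v i)) -take_nth ?size_tuple //.
  by rewrite take_oversize // size_tuple.
by rewrite {1}def_c nth_index_belast // -def_c c_full.
Qed.

(** * From translations to aperiodic transducers *)

(** Powers have to stabilise on the image of [h] only, with one exponent for all words. *)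
Definition aperiodic_morphism (A H : finType) (mul : H -> H -> H)
    (h : seq A -> H) : Prop :=
  [/\ associative mul, {morph h : u v / u ++ v >-> mul u v} &
      exists N, forall w, h (word_pow w N) = h (word_pow w N.+1)].

Lemma aperiodic_le (A H : finType) (mul : H -> H -> H) (h : seq A -> H) :
  {morph h : u v / u ++ v >-> mul u v} -> forall w N n,
  h (word_pow w N) = h (word_pow w N.+1) -> N <= n ->
  h (word_pow w n) = h (word_pow w n.+1).
Proof.
move=> hM w N n eqN /subnK <-.
by rewrite -addnS !word_powD [LHS]hM [RHS]hM eqN.
Qed.

Lemma aperiodic_morphism_pair (A H1 H2 : finType) mul1 mul2
    (h1 : seq A -> H1) (h2 : seq A -> H2) :
  aperiodic_morphism mul1 h1 -> aperiodic_morphism mul2 h2 ->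
  aperiodic_morphism (fun x y => (mul1 x.1 y.1, mul2 x.2 y.2))
    (fun w => (h1 w, h2 w)).
Proof.
case=> mul1A h1M [N1 eqN1] [mul2A h2M [N2 eqN2]]; split.
- by move=> [x1 x2] [y1 y2] [z1 z2] /=; rewrite mul1A mul2A.
- by move=> u v; rewrite h1M h2M.
exists (maxn N1 N2) => w.
rewrite (aperiodic_le h1M (eqN1 w) (leq_maxl _ _)).
by rewrite (aperiodic_le h2M (eqN2 w) (leq_maxr _ _)).
Qed.

Lemma aperiodic_morphism_map (A B H : finType) mul (h : seq B -> H) (g : A ->
  B) :
  aperiodic_morphism mul h -> aperiodic_morphism mul (fun w => h (map g w)).
Proof.
case=> mulA hM [N eqN]; split=> // [u v|]; first by rewrite map_cat hM.
by exists N => w; rewrite !map_word_pow.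
Qed.

(** * Words with one marked position *)

Section Marks.
Variable A : Type.

Definition unmarked (w : seq A) : seq (A * bool) := [seq (a, false) | a <- w].

Fixpoint marks (w : seq A) : seq (seq (A * bool)) :=
  if w is a :: w' then
    ((a, true) :: unmarked w') :: map (cons (a, false)) (marks w')
  else [::].

Lemma marks_cat u v :
  marks (u ++ v) =
  [seq m ++ unmarked v | m <- marks u] ++ [seq unmarked u ++ m | m <- marks v].
Proof.
elim: u => [|a u IHu] /=; first by rewrite map_id.
rewrite IHu map_cat -!map_comp; congr (_ :: _).
by rewrite /unmarked map_cat.
Qed.

End Marks.

(** The mark falls into one of the n copies of [w], with [i] copies before it and [k] after it. *)
Lemma mem_marks_pow (A : eqType) (w : seq A) n m :
  reflect (exists i k m', [/\ i + k.+1 = n, m' \in marks w &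
             m = word_pow (unmarked w) i ++ m' ++ word_pow (unmarked w) k])
          (m \in marks (word_pow w n)).
Proof.
apply: (iffP idP).
  elim: n m => // n IHn m; rewrite word_powS marks_cat mem_cat.
  case/orP=> /mapP[m' m'w ->]; first by exists 0, n, m';
    rewrite /unmarked map_word_pow.
  have [i [k [m2 [<- m2w ->]]]] := IHn _ m'w.
  by exists i.+1, k, m2; rewrite word_powS -!catA.
case=> i [k [m' [<- m'w ->]]]; rewrite word_powD word_powS !marks_cat mem_cat.
apply/orP; right; rewrite -!map_word_pow; apply/map_f.
by rewrite mem_cat; apply/orP; left; apply/mapP; exists m'.
Qed.

Section MarkMorphism.
Variables (A H : finType) (mul : H -> H -> H) (h : seq (A * bool) -> H).
Hypothesis hP : aperiodic_morphism mul h.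

(** A mark in a product lies in one factor while the other is unmarked. This is the product of upper
    triangular 2 by 2 matrices over sets, with [x.1] twice on the diagonal and [x.2] above it. *)
Definition mark_mul (x y : H * {set H}) : H * {set H} :=
  (mul x.1 y.1, [set mul z y.1 | z in x.2] :|: [set mul x.1 z | z in y.2]).

Definition mark_morphism (w : seq A) : H * {set H} :=
  (h (unmarked w), [set x in map h (marks w)]).

Lemma mark_morphism_aperiodic : aperiodic_morphism mark_mul mark_morphism.
Proof.
have [mulA hM [N eqN]] := hP; split.
- move=> [x X] [y Y] [z Z]; rewrite /mark_mul /= mulA; congr (_, _).
  rewrite !imsetU -setUA -!imset_comp; congr (_ :|: (_ :|: _)).
  + by apply: eq_imset => s /=; rewrite mulA.
  + by apply: eq_imset => s /=; rewrite mulA.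
  + by apply: eq_imset => s /=; rewrite mulA.
- move=> u v; rewrite /mark_morphism /mark_mul /= /unmarked map_cat hM;
    congr (_, _).
  apply/setP => x; rewrite !inE marks_cat map_cat mem_cat -!map_comp;
    congr (_ || _).
    apply/mapP/imsetP => [[m mu ->]|[y]].
      by exists (h m); rewrite ?inE ?map_f //= hM.
    by rewrite inE => /mapP[m mu ->] ->; exists m; rewrite //= hM.
  apply/mapP/imsetP => [[m mu ->]|[y]].
    by exists (h m); rewrite ?inE ?map_f //= hM.
  by rewrite inE => /mapP[m mu ->] ->; exists m; rewrite //= hM.
(* Among 2N + 1 copies, one carries the mark, so at least N unmarked copies lie on one side of it,
   and there a copy can be added; from 2N + 2 copies one can be removed likewise. *)
exists (N + N).+1 => w; have stab := aperiodic_le hM (eqN (unmarked w)).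
rewrite /mark_morphism /unmarked !map_word_pow; congr (_, _).
  by apply: stab; lia.
apply/setP => x; rewrite !inE; apply/mapP/mapP => -[m].
  case/mem_marks_pow=> i [k [m' [ikN m'w ->]]] ->.
  have [leNi|ltiN] := leqP N i.
    exists (word_pow (unmarked w) i.+1 ++ m' ++ word_pow (unmarked w) k).
      by apply/mem_marks_pow; exists i.+1, k, m'; rewrite addSn ikN.
    by rewrite [LHS]hM [RHS]hM stab.
  have leNk : N <= k by lia.
  exists (word_pow (unmarked w) i ++ m' ++ word_pow (unmarked w) k.+1).
    by apply/mem_marks_pow; exists i, k.+1, m'; rewrite addnS ikN.
  by rewrite !(catA _ m') [LHS]hM [RHS]hM (stab k).
case/mem_marks_pow=> i [k [m' [ikN m'w ->]]] ->.
have [ltNi|leiN] := ltnP N i.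
  case: i ltNi ikN => // i leNi ikN.
  exists (word_pow (unmarked w) i ++ m' ++ word_pow (unmarked w) k).
    by apply/mem_marks_pow; exists i, k, m'; split=> //; case: ikN.
  by rewrite [LHS]hM [RHS]hM (stab i).
case: k ikN => [|k] ikN; first lia.
exists (word_pow (unmarked w) i ++ m' ++ word_pow (unmarked w) k).
  by apply/mem_marks_pow; exists i, k, m'; split=> //; move: ikN;
    rewrite addnS => -[].
by rewrite !(catA _ m') [LHS]hM [RHS]hM -(stab k) //; lia.
Qed.

End MarkMorphism.

Lemma marks_map (T : eqType) (A : Type) (g : T -> A) (s : seq T) : uniq s ->
  marks (map g s) = [seq [seq (g i, j == i) | i <- s] | j <- s].
Proof.
elim: s => //= i s IHs /andP[iNs /IHs->]; rewrite eqxx /unmarked -!map_comp.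
congr (_ :: _).
  congr (_ :: _); apply/eq_in_map => j js /=.
  by congr (_, _); apply/esym/negbTE; apply: contraNneq iNs => ->.
apply/eq_in_map => j js /=; congr ((_, _) :: _); apply/esym.
by apply/negbTE; apply: contraNneq iNs => <-.
Qed.

(** * An aperiodic morphism for the order of two kinds of letters *)

Section LetterOrder.
Variables (A : finType) (p q : pred A).

Fixpoint before (w : seq A) : bool :=
  if w is a :: w' then (p a && has q w') || before w' else false.

Lemma beforeP a w :
  reflect (exists i j, [/\ i < j < size w, p (nth a w i) & q (nth a w j)])
          (before w).
Proof.
apply: (iffP idP).
  elim: w => //= b w IHw; case/orP=> [/andP[pb /(has_nthP a)[j lt_j qj]]|].
    by exists 0, j.+1.
  by case/IHw=> i [j [lt_ij pi qj]]; exists i.+1, j.+1.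
elim: w => [|b w IHw] [i [j [//= lt_ij pi qj]]];
  first by rewrite andbF in lt_ij.
case: i j => [|i] [|j] // in lt_ij pi qj *; apply/orP.
  by left; rewrite pi; apply/(has_nthP a); exists j.
by right; apply: IHw; exists i, j.
Qed.

Definition order_mul (x y : bool * bool * bool) : bool * bool * bool :=
  (x.1.1 || y.1.1, x.1.2 || y.1.2, [|| x.2, y.2 | x.1.1 && y.1.2]).

Definition order_morphism (w : seq A) := (has p w, has q w, before w).

Lemma order_morphism_aperiodic : aperiodic_morphism order_mul order_morphism.
Proof.
have hM u v : order_morphism (u ++ v) = order_mul (order_morphism u)
  (order_morphism v).
  rewrite /order_mul /order_morphism /= !has_cat; congr (_, _).
  elim: u => [|a u IHu] /=; first by rewrite orbF.
  rewrite IHu has_cat.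
  by case: (p a) (has q u) (has q v) (before u) (before v) (has p u); do 5!case.
split=> //; first by do 3!move=> [[[] []] []].
(* Exponent 1 would fail: a [p] letter with a later [q] letter may first arise across two copies of
   [w]. *)
exists 2 => w; rewrite !word_powS cats0 !hM.
by case: (order_morphism w) => [[[] []] []].
Qed.

End LetterOrder.

(** * Formulas recognised by aperiodic morphisms *)

Section Recognition.
Variable Sigma : finType.

(* A word with k distinguished positions is coded as a word whose letters carry
   k bits. *)
Definition annotated n k (w : n.+1.-tuple Sigma) (rho : k.-tuple 'I_n.+1) :
    seq (Sigma * k.-tuple bool) :=
  [seq (tnth w i, map_tuple (fun l => l == i) rho) | i <- enum 'I_n.+1].

(** Values lie in any [B], not just in [bool], so that the index returned by [find] can be
    recognised as well. *)
Definition recognised (B : eqType) k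
    (P : forall n, n.+1.-tuple Sigma -> k.-tuple 'I_n.+1 -> B) : Prop :=
  exists (H : finType) (mul : H -> H -> H) (h : seq (Sigma * k.-tuple bool) ->
    H)
    (out : H -> B), aperiodic_morphism mul h /\
    forall n (w : n.+1.-tuple Sigma) rho, P n w rho = out (h (annotated w rho)).

Lemma recognised_pair (B1 B2 B : eqType) k P1 P2 (op : B1 -> B2 -> B) :
  @recognised B1 k P1 -> @recognised B2 k P2 ->
  @recognised B k (fun n w rho => op (P1 n w rho) (P2 n w rho)).
Proof.
case=> H1 [mul1 [h1 [out1 [ap1 P1E]]]] [H2 [mul2 [h2 [out2 [ap2 P2E]]]]].
exists (H1 * H2)%type, (fun x y => (mul1 x.1 y.1, mul2 x.2 y.2)).
exists (fun w => (h1 w, h2 w)), (fun x => op (out1 x.1) (out2 x.2)).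
split; first exact: aperiodic_morphism_pair ap1 ap2.
by move=> n w rho; rewrite P1E P2E.
Qed.

Lemma recognised_map (B1 B : eqType) k P (op : B1 -> B) :
  @recognised B1 k P -> @recognised B k (fun n w rho => op (P n w rho)).
Proof.
case=> H [mul [h [out [ap PE]]]]; exists H, mul, h, (fun x => op (out x)).
by split=> // n w rho; rewrite PE.
Qed.

Lemma recognised_ext (B : eqType) k P1 P2 :
  (forall n w rho, P1 n w rho = P2 n w rho) ->
  @recognised B k P1 -> @recognised B k P2.
Proof.
move=> eqP12 [H [mul [h [out [ap PE]]]]]; exists H, mul, h, out.
by split=> // n w rho; rewrite -eqP12.
Qed.

(** [add] turns the mark into the bit of the bound variable, so the marked words are the annotations
    for all its values; the output asks for an accepted class among theirs. *)
Lemma recognised_exists k P : @recognised bool k.+1 P ->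
  recognised (fun n w (rho : k.-tuple _) => [exists j,
    P n w (cons_tuple j rho)]).
Proof.
case=> H [mul [h [out [ap PE]]]].
pose add (x : Sigma * k.-tuple bool * bool) := (x.1.1, cons_tuple x.2 x.1.2).
have ap_add := aperiodic_morphism_map add ap.
exists (H * {set H})%type, (mark_mul mul),
  (mark_morphism (fun w => h (map add w))).
exists (fun x : H * {set H} => [exists y in x.2, out y]).
split; first exact: mark_morphism_aperiodic ap_add.
move=> n w rho; rewrite /= marks_map ?enum_uniq // -!map_comp.
have markE (j : 'I_n.+1) : annotated w (cons_tuple j rho) = [seq add x | x <-
    [seq (tnth w i, map_tuple (fun l => l == i) rho,
      j == i) | i <- enum 'I_n.+1]].
  rewrite /annotated -map_comp; apply: eq_map => i; rewrite /add /=.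
  by congr (_, _); apply: val_inj.
apply/existsP/exists_inP => [[j]|[y]].
  rewrite PE => out_j; exists (h (annotated w (cons_tuple j rho))) => //.
  by rewrite inE; apply/mapP; exists j; rewrite ?mem_enum // markE.
by rewrite inE => /mapP[j _ ->] /=; rewrite -markE -PE; exists j.
Qed.

Definition at_term k (x : term k) (b : Sigma * k.-tuple bool) : bool :=
  if x is Var l then tnth b.2 l else true.

Lemma nth_annotated n (w : n.+1.-tuple Sigma) k (rho : k.-tuple 'I_n.+1) b
    (i : 'I_n.+1) :
  nth b (annotated w rho) i = (tnth w i, map_tuple (fun l => l == i) rho).
Proof. by rewrite (nth_map i) ?size_enum_ord // nth_ord_enum. Qed.

(* Letters do not show min and max, but a position before that of y witnesses
   min < y, and dually; only x = max and y = min have to be excluded. *)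
Lemma recognised_less k (x y : term k) :
  recognised (fun n w rho => sat w (Less Sigma x y) rho).
Proof.
pose possible :=
  (if x is Max then false else true) && (if y is Min then false else true).
exists (bool * bool * bool)%type, order_mul.
exists (order_morphism (at_term x) (at_term y)), (fun z => possible && z.2).
split; first exact: order_morphism_aperiodic.
move=> n w rho /=.
have size_annot : size (annotated w rho) = n.+1.
  by rewrite size_map size_enum_ord.
have b0 : Sigma * k.-tuple bool := (tnth w ord0, [tuple true | _ < k]).
apply/idP/andP => [lt_xy|[poss /(beforeP _ _ b0)[i [j []]]]].
  split; last first.
    apply/(beforeP _ _ b0); exists (eval_term rho x), (eval_term rho y).
    rewrite size_annot lt_xy ltn_ord !nth_annotated.
    by split=> //; [case: x {possible lt_xy}|case: y {possible lt_xy}] => //=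
      l; rewrite tnth_map eqxx.
  rewrite /possible; apply/andP; split.
    by case: x lt_xy {possible} => //=; rewrite ltnNge -ltnS ltn_ord.
  by case: y lt_xy {possible}.
rewrite size_annot => /andP[lt_ij lt_jn]; have lt_in := ltn_trans lt_ij lt_jn.
rewrite -[i]/(val (Ordinal lt_in)) -[j]/(val (Ordinal lt_jn)) !nth_annotated.
move=> at_x at_y.
have le_x : eval_term rho x <= i.
  case: x at_x {at_y} @possible poss => //= l; rewrite tnth_map => /eqP-> //.
apply: leq_ltn_trans le_x (leq_trans lt_ij _).
case: y at_y {at_x} @possible poss => /= [l| |].
- by rewrite tnth_map => /eqP->.
- by rewrite andbF.
- by rewrite -ltnS.
Qed.

(** For a variable, one looks for a letter a bearing its bit. Constants leave no bit, so a general
    term is reached through a fresh variable [z] equal to it, equality being two negated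
    comparisons. *)
Lemma recognised_letter k a (x : term k) :
  recognised (fun n w rho => sat w (Letter a x) rho).
Proof.
have rec_var m (l : 'I_m) : recognised (fun n w rho => sat w (Letter a (Var l))
  rho).
  pose at_a (b : Sigma * m.-tuple bool) := tnth b.2 l && (b.1 == a).
  exists (bool * bool * bool)%type, order_mul.
  exists (order_morphism at_a at_a), (fun z => z.1.1).
  split; first exact: order_morphism_aperiodic.
  move=> n w rho /=; rewrite has_map; apply/eqP/hasP => [wl|[i _]].
    exists (tnth rho l); first by rewrite mem_enum.
    by rewrite /= /at_a /= tnth_map eqxx wl eqxx.
  by rewrite /= /at_a /= tnth_map => /andP[/eqP-> /eqP].
pose z : term k.+1 := Var ord0.
have rec_z := recognised_exists (recognised_pair andb (rec_var _ ord0)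
  (recognised_pair andb
    (recognised_map negb (recognised_less z (term_shift x)))
    (recognised_map negb (recognised_less (term_shift x) z)))).
apply: recognised_ext rec_z => n w rho.
have shiftE j : eval_term (cons_tuple j rho) (term_shift x) = eval_term rho x.
  by case: x {z} => //= l; rewrite !(tnth_nth ord0).
apply/existsP/idP => [[j]|w_x]; last first.
  by exists (eval_term rho x); rewrite /= shiftE tnth0 ltnn; apply/andP.
rewrite /= shiftE tnth0 -!leqNgt -eqn_leq => /andP[w_j /eqP eq_xj].
by rewrite (_ : eval_term rho x = j) //; apply: val_inj.
Qed.

Lemma recognised_sat k (phi : formula Sigma k) :
  recognised (fun n w rho => sat w phi rho).
Proof.
elim: phi => {k} [k a x|k x y|k x y|k p IHp|k p IHp q IHq|k p IHp q IHq
                   |k p IHp|k p IHp].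
- exact: recognised_letter.
- exact: recognised_less.
- apply: recognised_ext (recognised_pair andb
    (recognised_map negb (recognised_less x y))
    (recognised_map negb (recognised_less y x))) => n w rho /=.
  by rewrite -!leqNgt -eqn_leq eq_sym.
- exact: recognised_map negb IHp.
- exact: recognised_pair andb IHp IHq.
- exact: recognised_pair orb IHp IHq.
- exact: recognised_exists IHp.
apply: recognised_ext (recognised_map negb
  (recognised_exists (recognised_map negb IHp))).
by move=> n w rho /=; rewrite negb_exists; apply: eq_forallb => j;
  rewrite negbK.
Qed.

Lemma recognised_find k (s : seq (formula Sigma k)) :
  recognised (fun n w rho => find (fun p => sat w p rho) s).
Proof.
elim: s => [|p s IHs] /=.
  exact: recognised_map (fun=> 0) (recognised_less Min Min).
exact: recognised_pair (fun (b : bool) i => if b then 0 else i.+1)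
  (recognised_sat p) IHs.
Qed.

Lemma annotated_single n (w : n.+1.-tuple Sigma) (i : 'I_n.+1) :
  annotated w [tuple i] =
  [seq (a, [tuple false]) | a <- take i w] ++ (tnth w i, [tuple true]) ::
  [seq (a, [tuple false]) | a <- drop i.+1 w].
Proof.
pose b0 := (tnth w ord0, [tuple false]); have lt_in := ltn_ord i.
have sz_take : size (take i w) = i by rewrite size_takel ?size_tuple // ltnW.
apply: (@eq_from_nth _ b0) => [|j].
  rewrite size_map size_enum_ord size_cat /= !size_map sz_take size_drop
    size_tuple.
  by lia.
rewrite size_map size_enum_ord => lt_jn.
rewrite -[j in LHS]/(val (Ordinal lt_jn)) nth_annotated nth_cat size_map
  sz_take /=.
rewrite (tnth_nth b0.1) /=.
have -> : map_tuple (fun l => l == Ordinal lt_jn) [tuple i] =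
    [tuple i == j :> nat].
  exact: val_inj.
have [lt_ji|lt_ij|eq_ij] := ltngtP j i; last first.
- by rewrite eq_ij subnn /= (tnth_nth b0.1 w i).
- have [m def_m] : exists m, j - i = m.+1 by exists (j - i.+1); lia.
  have def_j : j = i.+1 + m by lia.
  rewrite def_m /= (nth_map b0.1); first by rewrite nth_drop -def_j.
  by rewrite size_drop size_tuple; lia.
by rewrite (nth_map b0.1) ?sz_take // nth_take.
Qed.

End Recognition.

(** The classes of the prefix, of the marked letter and of the suffix multiply to the class of the
    annotated word, which determines the least satisfied formula. *)
Lemma fo_translation_bimachine (Sigma Gamma : finType) t
    (c : t.+1.-tuple Gamma) (phi : t.-tuple (formula Sigma 1)) :
  exists (H : finType) (mul : H -> H -> H) (h : seq Sigma -> H)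
    (g : H -> Sigma -> H -> Gamma), aperiodic_morphism mul h /\
    forall w a0, fo_translation c phi w =
      mkseq (fun i => g (h (take i w)) (nth a0 w i) (h (drop i.+1 w))) (size w).
Proof.
have [H [mul [h [out [ap outE]]]]] := recognised_find phi.
have [mulA hM _] := ap.
pose plain (a : Sigma) := (a, [tuple false]).
exists H, mul, (fun w => h (map plain w)).
exists (fun x a y => nth (tnth c ord_max) c
  (out (mul x (mul (h [:: (a, [tuple true])]) y)))).
split; first exact: aperiodic_morphism_map ap.
case=> [|a w] a0 //; rewrite /mkseq -[size (a :: w)]/(size w).+1 -val_enum_ord
  -map_comp.
apply: eq_map => i; rewrite /output_letter outE annotated_single [h (_ ++ _)]hM.
have hcons x u : h (x :: u) = mul (h [:: x]) (h u) by rewrite -hM.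
by rewrite hcons (tnth_nth a0).
Qed.

(** * The transducer that guesses suffix classes *)

Section Bimachine.
Variables (Sigma Gamma H : finType) (mul : H -> H -> H) (h : seq Sigma -> H).
Variable g : H -> Sigma -> H -> Gamma.
Hypothesis ap : aperiodic_morphism mul h.

(* A state holds the class of the prefix read so far and a guess of the class
   of the rest of the word; the initial state has not guessed yet. *)
Definition bimachine : transducer Sigma Gamma := {|
  state := (H * option H)%type;
  init := (h [::], None);
  delta := [set d : (H * option H) * Sigma * Gamma * (H * option H) |
    let: ((x, y), a, b, (x', y')) := d in
    if y' is Some z then
      [&& x' == mul x (h [:: a]), b == g x a z &
          if y is Some y0 then y0 == mul (h [:: a]) z else true]
    else false];
  final := [set s : H * option H | if s.2 is Some y then y == h [::] else true]
|}.

Fixpoint bimachine_output (u w : seq Sigma) : seq Gamma :=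
  if w is a :: w' then g (h u) a (h w') :: bimachine_output (rcons u a) w'
  else [::].

Lemma bimachine_outputE u w a0 :
  bimachine_output u w = mkseq (fun i =>
    g (h (u ++ take i w)) (nth a0 w i) (h (drop i.+1 w))) (size w).
Proof.
elim: w u => //= a w IHw u; rewrite IHw /mkseq /= cats0 drop0; congr (_ :: _).
rewrite -[1]/(1 + 0) iotaDl -map_comp; apply: eq_map => i /=.
by rewrite cat_rcons.
Qed.

(** The final state forces the last guess to be the class of the empty word, and each transition
    then forces the guess before it; so every guess is the class of the remaining word and the
    output is determined. *)
Lemma accepts_bimachine u y w v :
  @accepts _ _ bimachine (h u, y) w v =
  (if y is Some z then z == h w else true) && (v == bimachine_output u w).
Proof.
have [_ hM _] := ap; elim: w u y v => [|a w IHw] u y [|b v] //=.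
- by rewrite inE andbT.
- by rewrite andbF.
- by rewrite andbF.
rewrite eqseq_cons; apply/exists_inP/and3P => [[[x' [z|]]]|[yw /eqP-> /eqP->]].
- rewrite inE => /and3P[/eqP-> /eqP-> yz]; rewrite -hM cats1 IHw.
  case/andP=> /eqP def_z /eqP->; rewrite def_z in yz *.
  by rewrite -[a :: w]cat1s hM.
- by rewrite inE.
exists (h (rcons u a), Some (h w)); last by rewrite IHw !eqxx.
by rewrite inE -cats1 hM !eqxx /= -hM.
Qed.

(** The last guess determines the earlier ones, so the reachable set depends on [u] only through
    [h u]. The empty word is excluded: it leaves a missing guess missing, and [h [::]] need not be a
    unit of [H]. *)
Lemma delta_star_bimachine x y u p : u != [::] ->
  (p \in @delta_star _ _ bimachine (x, y) u) =
  (p.1 == mul x (h u)) && (if p.2 is Some z then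
    if y is Some y0 then y0 == mul (h u) z else true else false).
Proof.
have [mulA hM _] := ap; elim: u x y p => // a u IHu x y p _.
apply/delta_star_consP/andP => [[b [[x' [z|]] []]]|].
- rewrite inE => /and3P[/eqP-> _ yz].
  case: u IHu => [|a' u] IHu; first by rewrite inE => /eqP->; rewrite eqxx.
  rewrite IHu // => /andP[/eqP-> pz]; rewrite -mulA -hM; split=> //.
  case: (p.2) pz => // z' /eqP def_z; case: y yz => // y0;
    rewrite def_z mulA -hM //.
- by rewrite inE.
case: p => x' [z|] [//= /eqP-> yz].
have h_cons : h (a :: u) = if u is [::] then h [:: a] else mul (h [:: a]) (h u).
  by case: (u) => // a' u'; rewrite -hM.
(* The guess after the first letter is computed back from the last guess [z]; for empty [u] it is
   [z] itself. *)
exists (g x a (if u is [::] then z else mul (h u) z)).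
exists (mul x (h [:: a]), Some (if u is [::] then z else mul (h u) z)).
split; first rewrite inE !eqxx /=.
  by case: y yz => // y0; rewrite h_cons; case: (u) => // a' u'; rewrite mulA.
rewrite h_cons; case: u IHu {h_cons yz} => [|a' u] IHu; first by rewrite inE.
by rewrite IHu //= -mulA !eqxx.
Qed.

Lemma bimachine_aperiodic : aperiodic bimachine.
Proof.
(* The successor makes the powers of a nonempty word nonempty. *)
have [_ hM [N eqN]] := ap; exists N.+1 => -[x y] [|a w] //.
by apply/setP => p; rewrite !delta_star_bimachine // (aperiodic_le hM (eqN _)).
Qed.

End Bimachine.

Theorem fo_translation_aperiodic (Sigma Gamma : finType) t
    (c : t.+1.-tuple Gamma) (phi : t.-tuple (formula Sigma 1)) :
  exists M : transducer Sigma Gamma,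
    [/\ single_valued M, aperiodic M & defines M (fo_translation c phi)].
Proof.
have [H [mul [h [g [ap fE]]]]] := fo_translation_bimachine c phi.
have outE w : fo_translation c phi w = bimachine_output h g [::] w.
  (* The default letter is taken from the word, since [Sigma] may be empty. *)
  case: w => // a w; rewrite (fE _ a) (bimachine_outputE _ _ _ _ a).
  by [].
have memE n (w : n.-tuple Sigma) (v : n.-tuple Gamma) :
    (v \in outputs (bimachine mul h g) w) =
    (v == fo_translation c phi w :> seq _).
  by rewrite mem_outputs accepts_bimachine // outE.
have size_f n (w : n.-tuple Sigma) : size (fo_translation c phi w) == n.
  case: n w => [|n] w; first by rewrite (tuple0 w).
  by rewrite (fE w (tnth w ord0)) size_mkseq size_tuple.
exists (bimachine mul h g); split; last 1 first.
- by move=> n w; exists (Tuple (size_f n w)); rewrite ?memE.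
- move=> n w; apply/eqP/cards1P; exists (Tuple (size_f n w)).
  by apply/setP => v; rewrite memE inE.
exact: bimachine_aperiodic.
Qed.

Theorem theorem10 (Sigma Gamma : finType) (t : nat) (c : t.+1.-tuple Gamma)
    (c_uniq : uniq c) (c_full : forall b : Gamma, b \in c)
    (f : seq Sigma -> seq Gamma) :
  (exists phi : t.-tuple (formula Sigma 1),
     forall w : seq Sigma, f w = fo_translation c phi w) <->
  (exists M : transducer Sigma Gamma,
     [/\ single_valued M, aperiodic M & defines M f]).
Proof.
split=> [[phi f_phi]|[M [M_sv M_ap M_f]]]; last first.
  exact: aperiodic_fo_translation M_f.
have [M [M_sv M_ap M_phi]] := fo_translation_aperiodic c phi.
by exists M; split=> // n w; rewrite f_phi; apply: M_phi.
Qed.
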